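(* Let $G=(V,E)$ be a finite simple connected graph, and let $F:\mathbb F_2^{V}\to \mathbb F_2^{V}$ be the map given by $F(s)=(1+s)(1+P_s)$, where $P_s(v)=\prod_{x\in N(v)}(1+s(x))$ for $v\in V$. The only fixed point of $F$ is $c_0$. In particular, $\mathrm{Surj}(\mathbb F_2^{V})$ does not contain any fixed points of $F$.
   Context: Graphs are undirected. $\mathbb F_2=\{0,1\}$ is the field with two elements and $\mathbb F_2^{V}$ is the set of functions (''configurations'') $V\to\mathbb F_2$, with pointwise addition and multiplication; $1$ denotes the constant function $1$. $N(v)=\{x\in V : vx\in E\}$ is the open neighborhood of $v$; empty products equal $1$. $c_i$ is the constant function with value $i\in\{0,1\}$, and $\mathrm{Surj}(\mathbb F_2^{V})=\mathbb F_2^{V}\setminus\{c_0,c_1\}$. *)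

(* Defs.v *)
From mathcomp Require Import all_boot all_algebra.

Set Implicit Arguments.
Unset Strict Implicit.
Unset Printing Implicit Defensive.

Import GRing.Theory.

Local Open Scope ring_scope.

(* A finite simple graph on [V] is a symmetric irreflexive adjacency relation. *)
Definition simple_graph (V : finType) (e : rel V) : Prop :=
  symmetric e /\ irreflexive e.

(* The graph with no vertices satisfies this. *)
Definition connected_graph (V : finType) (e : rel V) : Prop :=
  forall x y : V, connect e x y.

Definition nbhd (V : finType) (e : rel V) (v : V) : {set V} :=
  [set x | e v x].

Definition cst_config (V : finType) (i : 'F_2) : {ffun V -> 'F_2} :=
  [ffun _ => i].

Definition Surj_config (V : finType) : {set {ffun V -> 'F_2}} :=
  ~: [set cst_config V 0; cst_config V 1].

Definition nbhd_prod (V : finType) (e : rel V) (s : {ffun V -> 'F_2}) :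
    {ffun V -> 'F_2} :=
  [ffun v => \prod_(x in nbhd e v) (1 + s x)].

(* [+], [*] and [1] are those of the pointwise ring on [{ffun V -> 'F_2}]. *)
Definition config_map (V : finType) (e : rel V) (s : {ffun V -> 'F_2}) :
    {ffun V -> 'F_2} :=
  (1 + s) * (1 + nbhd_prod e s).

(* Main.v *)
Require Import Defs.
From mathcomp Require Import all_boot all_algebra.

Import GRing.Theory.

(** At a vertex where [s] takes the value 1, the factor [1 + s] vanishes, so [F s] takes
    the value 0 there: a fixed point never takes the value 1.  Conversely, if [s = 0]
    then [P_s = 1], and [1 + P_s = 0] in characteristic 2. *)

Lemma F2_add11 : (1 + 1 = 0 :> 'F_2)%R.
Proof. exact/val_inj. Qed.

Lemma F2_eq0_or_eq1 (x : 'F_2) : (x = 0 \/ x = 1)%R.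
(* Elements of ['F_2] are ordinals below 2, so the bound rules out every value from 2 on. *)
Proof. by case: x => [[|[|//]] ?]; [left | right]; apply: val_inj. Qed.

Lemma config_mapE (V : finType) (e : rel V) (s : {ffun V -> 'F_2}) (v : V) :
  config_map e s v =
    ((1 + s v) * (1 + \prod_(x in nbhd e v) (1 + s x)))%R.
Proof. by rewrite /config_map !ffunE. Qed.

Lemma config_map_fixed_point (V : finType) (e : rel V) (s : {ffun V -> 'F_2}) :
  config_map e s = s <-> s = cst_config V 0%R.
Proof.
split=> [Fs | ->]; apply/ffunP=> v.
  have := config_mapE V e s v; rewrite Fs ffunE.
  (* If [s v = 1], the fixed-point equation at [v] collapses to [1 = 0], which is then the goal
     itself. *)
  by case: (F2_eq0_or_eq1 (s v)) => -> //; rewrite F2_add11 mul0r.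
(* Every factor is [1 + 0], so the product is 1, also over an empty neighborhood. *)
rewrite config_mapE big1 => [|x _]; last by rewrite ffunE addr0.
by rewrite F2_add11 mulr0 ffunE.
Qed.

Theorem proposition3p6 (V : finType) (e : rel V)
  (G_simple : simple_graph e) (G_connected : connected_graph e) :
  (forall s : {ffun V -> 'F_2}, config_map e s = s <-> s = cst_config V 0%R) /\
  ~ (exists s : {ffun V -> 'F_2}, s \in Surj_config V /\ config_map e s = s).
Proof.
split=> [s | [s [s_surj /config_map_fixed_point s0]]].
  exact: config_map_fixed_point.
(* [cst_config V 0] is one of the two configurations that [Surj_config V] excludes. *)
by move: s_surj; rewrite s0 !inE eqxx.
Qed.
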